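(* Let $M$ be a matroid with ground set $E(M)$ and let $M'$ be a matroid obtained from $M$ by (a) a deletion $M\setminus e$ of some $e\in E(M)$, or (b) a series contraction, i.e. $M'=M/e$ where $e$ is contained in a $2$-element cocircuit of $M$, or (c) a coloop contraction, i.e. $M'=M/e$ where $e$ is a coloop of $M$. Then $P_{\mathrm{Cyc}}(M')$ is affinely isomorphic to a face of $P_{\mathrm{Cyc}}(M)$. In particular, if $M'$ is a series minor of $M$, then $P_{\mathrm{Cyc}}(M')$ is affinely isomorphic to a face of $P_{\mathrm{Cyc}}(M)$.
   Context: Throughout, matroids are finite and non-free (they have at least one circuit; in particular their ground set is non-empty). A cycle of a matroid $M$ is a disjoint union of (possibly zero) circuits of $M$; $\mathrm{Cyc}(M)$ denotes the set of cycles, so $\emptyset\in\mathrm{Cyc}(M)$. The cycle polytope $P_{\mathrm{Cyc}}(M)\subseteq\mathbb{R}^{E(M)}$ is the convex hull of the characteristic vectors $\chi_C\in\{0,1\}^{E(M)}$ of all cycles $C$ of $M$. A coloop is an element $e$ such that $\{e\}$ is a circuit of the dual matroid $M^*$. A series minor of $M$ is a matroid obtained from $M$ by a sequence of deletions and series contractions. A morphism of polytopes $P,Q$ is a map $P\to Q$ extendable to an affine map $\mathrm{aff}(P)\to\mathrm{aff}(Q)$; $P$ and $Q$ are affinely isomorphic if there is a morphism $P\to Q$ with an inverse morphism. A face of a polytope is its intersection with a supporting hyperplane. *)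

(* Defs.v *)
(* [classical_sets] comes first so that [set0], [setU], ... are those of finset. *)
From mathcomp Require Import classical_sets reals.
From mathcomp Require Import all_boot all_order all_algebra.

Set Implicit Arguments.
Unset Strict Implicit.
Unset Printing Implicit Defensive.

Import Order.TTheory GRing.Theory Num.Theory.

Section Matroid.
Variable T : finType.

Record matroid := Matroid {
  ground : {set T};
  indep : {set {set T}};
  indep_sub : forall I : {set T}, I \in indep -> I \subset ground;
  indep0 : set0 \in indep;
  indep_hered : forall I J : {set T}, J \in indep -> I \subset J -> I \in indep;
  indep_aug : forall I J : {set T},
    I \in indep -> J \in indep -> #|I| < #|J| ->
      exists2 x, x \in J :\: I & x |: I \in indep }.

Implicit Types (M : matroid) (e : T) (B C D I J : {set T}).

Definition is_basis M B := maxset [pred I | I \in indep M] B.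

Definition circuit M C :=
  minset [pred D : {set T} | (D \subset ground M) && (D \notin indep M)] C.

Definition nonfree M := exists C, circuit M C.

(* A union of pairwise disjoint circuits; [P = set0] gives the empty cycle.   *)
(* Circuits are nonempty, so [trivIset] is pairwise disjointness.             *)
Definition is_cycle M C :=
  exists P : {set {set T}},
    [/\ forall D, D \in P -> circuit M D, trivIset P & C = cover P].

Lemma is_basisP M B : is_basis M B -> B \in indep M.
Proof. by move/maxsetP=> []. Qed.

Lemma basis_exists M I : I \in indep M -> exists2 B, is_basis M B & I \subset B.
Proof.
by move=> hI; have [|B hB sIB] := @maxset_exists _ [pred I | I \in indep M] I;
  last exists B.
Qed.

Lemma card_indep_basis M I B : I \in indep M -> is_basis M B -> #|I| <= #|B|.
Proof.
move=> hI hB; rewrite leqNgt; apply/negP => ltBI.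
have [x] := indep_aug (is_basisP hB) hI ltBI.
rewrite inE => /andP[xNB _] hxB; case/maxsetP: hB => _ /(_ _ hxB).
move=> /(_ (subsetUr _ _)) eqB; move: xNB; rewrite -eqB.
by rewrite in_setU1 eqxx.
Qed.

Lemma basis_extend M I B : I \in indep M -> is_basis M B ->
  exists B', [/\ is_basis M B', I \subset B' & B' \subset I :|: B].
Proof.
move=> hI hB.
have [|B' /maxsetP[/= /andP[hB' sB'] maxB'] sIB'] :=
  @maxset_exists _ [pred J : {set T} | (J \in indep M) && (J \subset I :|: B)] I.
  by rewrite /= hI subsetUl.
have leBB' : #|B| <= #|B'|.
  rewrite leqNgt; apply/negP => lt.
  have [x] := indep_aug hB' (is_basisP hB) lt.
  rewrite inE => /andP[xNB' xB] hx; move: xNB'.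
  rewrite -(maxB' (x |: B')) ?subsetUr ?in_setU1 ?eqxx //=.
  by rewrite hx subUset sB' sub1set inE xB orbT.
exists B'; split=> //; apply/maxsetP; split=> //= K hK sB'K.
apply/eqP; rewrite eq_sym eqEcard sB'K /=.
exact: leq_trans (card_indep_basis hK hB) leBB'.
Qed.

Definition dual_indep M : {set {set T}} :=
  [set I : {set T} |
    (I \subset ground M) && [exists B, is_basis M B && [disjoint I & B]]].

Lemma dual_indepP M I :
  reflect (I \subset ground M /\ exists2 B, is_basis M B & [disjoint I & B])
          (I \in dual_indep M).
Proof.
rewrite inE; apply: (iffP andP) => [[-> /existsP[B /andP[? ?]]]|[-> [B ? ?]]].
  by split=> //; exists B.
by split=> //; apply/existsP; exists B; apply/andP.
Qed.

Lemma dual_indep_sub M I : I \in dual_indep M -> I \subset ground M.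
Proof. by case/dual_indepP. Qed.

Lemma dual_indep0 M : set0 \in dual_indep M.
Proof.
apply/dual_indepP; split; first exact: sub0set.
have [B hB _] := basis_exists (indep0 M).
by exists B => //; rewrite disjoints_subset sub0set.
Qed.

Lemma dual_indep_hered M I J :
  J \in dual_indep M -> I \subset J -> I \in dual_indep M.
Proof.
move=> /dual_indepP[sJ [B hB dJB]] sIJ; apply/dual_indepP.
by split; [exact: subset_trans sJ | exists B => //; exact: disjointWl dJB].
Qed.

Lemma dual_indep_aug M I J :
  I \in dual_indep M -> J \in dual_indep M -> #|I| < #|J| ->
  exists2 x, x \in J :\: I & x |: I \in dual_indep M.
Proof.
move=> /dual_indepP[sI [BI hBI dI]] /dual_indepP[sJ [BJ hBJ dJ]] ltIJ.
have hX : BJ :\: I \in indep M.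
  by apply: indep_hered (is_basisP hBJ) _; exact: subsetDl.
have [B [hB sXB sB]] := basis_extend hX hBI.
have dIB : [disjoint I & B].
  rewrite disjoint_sym; apply: disjointWl sB _.
  rewrite disjoint_sym disjoints_subset; apply/subsetP => x xI.
  rewrite !inE xI /=; apply: contraTN xI => xB.
  by rewrite (disjointFl dI xB).
have [sJB|] := boolP (J :\: I \subset B); last first.
  case/subsetPn=> x xJI xNB; exists x => //; apply/dual_indepP; split.
    rewrite subUset sI sub1set andbT.
    by move: xJI; rewrite inE => /andP[_ /(subsetP sJ)].
  by exists B => //; rewrite disjoints_subset subUset sub1set inE xNB -disjoints_subset.
have dd : [disjoint BJ :\: I & J :\: I].
  apply: disjointWl (subsetDl _ _) _; apply: disjointWr (subsetDl _ _) _.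
  by rewrite disjoint_sym.
have : #|BJ :\: I| + #|J :\: I| <= #|BJ|.
  have /eqP <- : #|(BJ :\: I) :|: (J :\: I)| == #|BJ :\: I| + #|J :\: I|.
    by rewrite (leq_card_setU _ _).2.
  apply: leq_trans (card_indep_basis (is_basisP hB) hBJ).
  by apply: subset_leq_card; rewrite subUset sXB.
rewrite -[X in _ <= X](cardsID I BJ) addnC leq_add2r => le1.
have le2 : #|BJ :&: I| <= #|I :\: J|.
  apply: subset_leq_card; apply/subsetP => x; rewrite !inE => /andP[xB ->].
  by rewrite andbT; rewrite (disjointFl dJ xB).
have : #|J| <= #|I|.
  by rewrite -(cardsID I J) -(cardsID J I) setIC leq_add2l (leq_trans le1).
by rewrite leqNgt ltIJ.
Qed.

Definition mdual M : matroid :=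
  Matroid (@dual_indep_sub M) (dual_indep0 M) (@dual_indep_hered M)
          (@dual_indep_aug M).

Definition mdel_indep M e : {set {set T}} := [set I in indep M | e \notin I].

Lemma mdel_indep_sub M e I : I \in mdel_indep M e -> I \subset ground M :\ e.
Proof. by rewrite inE => /andP[/indep_sub sI eNI]; rewrite subsetD1 sI. Qed.

Lemma mdel_indep0 M e : set0 \in mdel_indep M e.
Proof. by rewrite !inE indep0. Qed.

Lemma mdel_indep_hered M e I J :
  J \in mdel_indep M e -> I \subset J -> I \in mdel_indep M e.
Proof.
rewrite !inE => /andP[hJ eNJ] sIJ; rewrite (indep_hered hJ sIJ) /=.
by apply: contra eNJ; exact: (subsetP sIJ).
Qed.

Lemma mdel_indep_aug M e I J :
  I \in mdel_indep M e -> J \in mdel_indep M e -> #|I| < #|J| ->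
  exists2 x, x \in J :\: I & x |: I \in mdel_indep M e.
Proof.
rewrite !inE => /andP[hI eNI] /andP[hJ eNJ] ltIJ.
have [x xJI hx] := indep_aug hI hJ ltIJ; exists x => //.
rewrite !inE hx negb_or eNI andbT /=; apply: contraNneq eNJ => ->.
by move: xJI; rewrite inE => /andP[].
Qed.

Definition mdel M e : matroid :=
  Matroid (@mdel_indep_sub M e) (mdel_indep0 M e) (@mdel_indep_hered M e)
          (@mdel_indep_aug M e).

(* M / e is the dual of the deletion of e from the dual. *)
Definition mcontr M e : matroid := mdual (mdel (mdual M) e).

Definition cocircuit M := circuit (mdual M).

Definition coloop M e := cocircuit M [set e].

(* [e] lies in a 2-element cocircuit, so contracting it is a series contraction. *)
Definition in_series_pair M e :=
  exists D, [/\ cocircuit M D, #|D| = 2 & e \in D].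

Inductive series_minor M : matroid -> Prop :=
| series_minor_refl : series_minor M M
| series_minor_del N e :
    series_minor M N -> e \in ground N -> series_minor M (mdel N e)
| series_minor_contr N e :
    series_minor M N -> in_series_pair N e -> series_minor M (mcontr N e).

End Matroid.

Local Open Scope ring_scope.
Local Open Scope classical_set_scope.

Section Affine.
Variable R : realType.

Definition conv_hull (V : lmodType R) (A : set V) : set V :=
  [set x | exists (n : nat) (c : 'I_n -> R) (p : 'I_n -> V),
    [/\ forall i, A (p i), forall i, 0 <= c i, \sum_i c i = 1
      & x = \sum_i c i *: p i]].

Definition aff_hull (V : lmodType R) (A : set V) : set V :=
  [set x | exists (n : nat) (c : 'I_n -> R) (p : 'I_n -> V),
    [/\ forall i, A (p i), \sum_i c i = 1 & x = \sum_i c i *: p i]].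

Definition affine_on (V W : lmodType R) (A : set V) (g : V -> W) :=
  forall (n : nat) (c : 'I_n -> R) (p : 'I_n -> V),
    (forall i, A (p i)) -> \sum_i c i = 1 ->
    g (\sum_i c i *: p i) = \sum_i c i *: g (p i).

(* Only the values of [f] on [P] and of [g] on [aff_hull P] matter.           *)
Definition polytope_morphism (V W : lmodType R) (P : set V) (Q : set W)
    (f : V -> W) :=
  (forall x, P x -> Q (f x)) /\
  exists g : V -> W,
    [/\ forall x, aff_hull P x -> aff_hull Q (g x),
        affine_on (aff_hull P) g
      & forall x, P x -> g x = f x].

Definition affinely_isomorphic (V W : lmodType R) (P : set V) (Q : set W) :=
  exists (f : V -> W) (h : W -> V),
    [/\ polytope_morphism P Q f, polytope_morphism Q P h,
        forall x, P x -> h (f x) = x & forall y, Q y -> f (h y) = y].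

(* [R^o] is [R] as a module over itself: [{ffun I -> R^o}] is the space R^I.  *)
Definition hyperplane (I : finType) (a : {ffun I -> R^o}) (b : R) :
    set {ffun I -> R^o} :=
  [set x | \sum_i a i * x i = b].

Definition supporting (I : finType) (P : set {ffun I -> R^o})
    (a : {ffun I -> R^o}) (b : R) :=
  [/\ a != 0, forall x, P x -> \sum_i a i * x i <= b
    & exists x, P x /\ hyperplane a b x].

(* Since [a != 0], a full-dimensional [P] is not a face of itself here, while *)
(* a [P] lying in a hyperplane is.                                            *)
Definition is_face (I : finType) (P F : set {ffun I -> R^o}) :=
  exists a b, supporting P a b /\ F = P `&` hyperplane a b.

Definition char_vec (T : finType) (E C : {set T}) :
    {ffun {x : T | x \in E} -> R^o} :=
  [ffun x => (val x \in C)%:R].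

Definition cycle_polytope (T : finType) (M : matroid T) :
    set {ffun {x : T | x \in ground M} -> R^o} :=
  conv_hull [set v | exists2 C, is_cycle M C & v = char_vec (ground M) C].

End Affine.

Arguments cycle_polytope R {T} M _.

(* Main.v *)
Require Import Defs.
From HB Require Import structures.
From mathcomp Require Import classical_sets reals.
From mathcomp Require Import all_boot all_order all_algebra.

(* A cycle of [M \ e] is a cycle of [M] missing [e], so deletion cuts out the
   face [x_e = 0]. A circuit and a cocircuit never meet in exactly one element:
   a coloop thus lies in no cycle, and the elements of a 2-element cocircuit
   [{e, f}] lie in the same cycles. Hence [x_e = 0], respectively [x_e = x_f], on
   the whole polytope, and contracting [e] merely forgets the coordinate [x_e],
   which the others determine. These coordinate descriptions compose, so a
   sequence of operations needs no transitivity of faces: the deleted elements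
   [D] give the valid inequality [sum_(d in D) - x_d <= 0], and if nothing is
   deleted one of the equations above is a nonzero form vanishing on the polytope. *)

Set Implicit Arguments.
Unset Strict Implicit.
Unset Printing Implicit Defensive.

Import Order.TTheory GRing.Theory Num.Theory.

Section Matroids.
Variable T : finType.
Implicit Types (M N L : matroid T) (e f : T) (B C D I X Y : {set T}).
Implicit Types (k : option T) (g : T -> option T).

(** * Bases, circuits and cycles *)

Lemma basis_sub_eq M B B' : is_basis M B -> is_basis M B' -> B' \subset B -> B' = B.
Proof. by move=> hB /maxsetP[_ maxB'] sB; rewrite (maxB' B) //=; apply: is_basisP. Qed.

Lemma circuitP M C :
  reflect [/\ C \subset ground M, C \notin indep M
            & forall Y, Y \subset C -> Y \notin indep M -> Y = C]
          (circuit M C).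
Proof.
apply: (iffP minsetP) => [[/andP[sC dC] minC]|[sC dC minC]].
  by split=> // Y sY dY; apply: minC => //=; rewrite dY (subset_trans sY).
split=> /= [|Y /andP[_ dY] sY]; first by rewrite sC.
by apply: minC.
Qed.

Lemma circuit_sub M C : circuit M C -> C \subset ground M.
Proof. by case/circuitP. Qed.

Lemma circuit_exists M X : X \subset ground M -> X \notin indep M ->
  exists2 C, circuit M C & C \subset X.
Proof.
move=> sX dX.
have [|C] := @minset_exists _ [pred D : {set T} | (D \subset ground M) && (D \notin indep M)] X.
  by rewrite /= sX.
by exists C.
Qed.

Lemma cycle_sub M C : is_cycle M C -> C \subset ground M.
Proof.
by case=> P [hP _ ->]; apply/bigcupsP => D /hP /circuit_sub.
Qed.

Lemma cycle0 M : is_cycle M set0.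
Proof.
exists set0; split; first by move=> D; rewrite inE.
  by apply/trivIsetP => A B; rewrite inE.
by rewrite /cover big_set0.
Qed.

Lemma bigcup_setD1 (P : {set {set T}}) (F : {set T} -> {set T}) e :
  (\bigcup_(D in P) F D) :\ e = \bigcup_(D in P) (F D :\ e).
Proof.
apply/setP => x; apply/setD1P/bigcupP => [[xNe /bigcupP[D DP xD]]|[D DP /setD1P[xNe xD]]].
  by exists D; rewrite // in_setD1 xNe.
by split=> //; apply/bigcupP; exists D.
Qed.

(** Serves to move a decomposition into circuits between [M] and [mcontr M e], where every circuit
    of the family is modified by the same rule [u]. *)
Lemma is_cycle_bigcup M (P : {set {set T}}) (u : {set T} -> {set T}) :
  (forall D, D \in P -> circuit M (u D)) ->
  {in P &, forall A B, A != B -> [disjoint u A & u B]} ->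
  is_cycle M (\bigcup_(D in P) u D).
Proof.
move=> hu dis; exists (u @: P); split.
- by move=> _ /imsetP[D DP ->]; exact: hu.
- apply/trivIsetP => _ _ /imsetP[A AP ->] /imsetP[B BP ->] neq.
  by apply: dis => //; apply: contraNneq neq => ->.
- by rewrite cover_imset.
Qed.

(** * Intersections of circuits and cocircuits *)

(** By minimality [D :\ e] misses some basis. If [e] were a loop, that basis would miss [e] too,
    making [D] independent in the dual. *)
Lemma cocircuit_elem_indep M D e : cocircuit M D -> e \in D -> [set e] \in indep M.
Proof.
case/circuitP=> sD dD minD eD.
have : D :\ e \in dual_indep M.
  apply/negPn/negP => /(minD _ (subsetDl _ _)) eqD.
  by move: eD; rewrite -eqD !inE eqxx.
case/dual_indepP => _ [B hB dis].
apply: contraR dD => dep; apply/dual_indepP; split=> //; exists B => //.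
rewrite -(setD1K eD) disjoints_subset subUset -[_ :\ e \subset _]disjoints_subset dis andbT.
rewrite sub1set inE; apply: contra dep => eB.
by apply: indep_hered (is_basisP hB) _; rewrite sub1set.
Qed.

(* Were [C :&: D = [set e]], a basis containing [C :\ e] and avoiding [D :\ e]
   would have to meet [D] in [e], hence contain [C]. *)
Lemma circuit_cocircuit M C D e : circuit M C -> cocircuit M D ->
  C :&: D != [set e].
Proof.
case/circuitP=> sC dC minC /circuitP[sD dD minD]; apply/eqP => CD.
have /andP[eC eD] : (e \in C) && (e \in D) by rewrite -in_setI CD set11.
have iC : C :\ e \in indep M.
  apply/negPn/negP => /(minC _ (subsetDl _ _)) eqC.
  by move: eC; rewrite -eqC !inE eqxx.
have : D :\ e \in dual_indep M.
  apply/negPn/negP => /(minD _ (subsetDl _ _)) eqD.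
  by move: eD; rewrite -eqD !inE eqxx.
case/dual_indepP => _ [B hB dis].
have [B' [hB' sCB' sB']] := basis_extend iC hB.
have NB' : forall x, x \in D -> x \in B' -> x = e.
  move=> x xD xB'; apply/eqP; apply/negPn/negP => xNe.
  have xDe : x \in D :\ e by rewrite !inE xNe.
  move/(subsetP sB'): xB'; rewrite !inE xNe (disjointFr dis xDe) orbF /= => xC.
  by move: xNe; rewrite -in_set1 -CD inE xC xD.
have eB' : e \in B'.
  apply: contraR dD => eNB'; apply/dual_indepP; split=> //; exists B' => //.
  rewrite disjoints_subset; apply/subsetP => x xD; rewrite inE.
  by apply: contra eNB' => xB'; rewrite -(NB' x).
case/negP: dC; apply: indep_hered (is_basisP hB') _.
by rewrite -(setD1K eC) subUset sub1set eB'.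
Qed.

(** * Independent sets, circuits and cycles after deletion and contraction *)

Lemma ground_mcontr M e : ground (mcontr M e) = ground M :\ e.
Proof. by []. Qed.

(** As [e] is not a loop, the bases of [mdel (mdual M) e] are exactly the complements of the bases
    of [M] through [e]. Dualizing leaves the sets that together with [e] fit into such a basis. *)
Lemma mcontr_indep M e I : [set e] \in indep M -> I \subset ground M :\ e ->
  (I \in indep (mcontr M e)) = (e |: I \in indep M).
Proof.
move=> ie sI; apply/dual_indepP/idP => [[_ [Bs hBs dIBs]]|iI].
  move/maxsetP: (hBs) => [/= hBs' maxBs].
  move: hBs'; rewrite in_set => /andP[/dual_indepP[sBs [B0 hB0 dB0]] eNBs].
  (* Replacing [B0] by a basis [B] through [e] inside [e |: B0] keeps it disjoint from [Bs], because
     [Bs] misses [e]. *)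
  have [B [hB eB sB]] := basis_extend ie hB0.
  rewrite sub1set in eB.
  have dB : [disjoint Bs & B].
    rewrite disjoints_subset; apply/subsetP => x xBs; rewrite inE.
    apply/negP => /(subsetP sB); rewrite !inE (disjointFr dB0 xBs) orbF => /eqP xe.
    by rewrite -xe xBs in eNBs.
  have eqBs : ground M :\: B = Bs.
    apply: maxBs; last by rewrite subsetD sBs.
    rewrite /= in_set !in_setD eB andbT; apply/dual_indepP; split; first exact: subsetDl.
    by exists B => //; rewrite disjoints_subset setDE subsetIr.
  apply: indep_hered (is_basisP hB) _; rewrite subUset sub1set eB /=.
  apply/subsetP => x xI; have := disjointFr dIBs xI; rewrite -eqBs !inE.
  by move/(subsetP sI): xI; rewrite !inE => /andP[_ ->]; rewrite andbT => /negbFE.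
split=> //; have [B hB] := basis_exists iI.
rewrite subUset sub1set => /andP[eB sIB].
exists (ground M :\: B); last first.
  by rewrite disjoint_sym disjoints_subset setDE subIset // setCS sIB orbT.
apply/maxsetP; split=> /= [|K].
  rewrite in_set !in_setD eB andbT; apply/dual_indepP; split; first exact: subsetDl.
  exists B => //.
  by rewrite disjoints_subset setDE subsetIr.
rewrite in_set => /andP[/dual_indepP[sK [B' hB' dK]] _] sBK.
(* [K] contains the complement of [B] and misses [B'], so [B'] lies inside [B]. *)
have eqB : B' = B.
  apply: (basis_sub_eq hB hB'); apply/subsetP => x xB'.
  have /subsetP/(_ _ xB') xM := indep_sub (is_basisP hB').
  have := disjointFl dK xB'; apply: contraFT => xNB.
  by apply: (subsetP sBK); rewrite inE xNB.
by apply/eqP; rewrite eqEsubset sBK andbT subsetD sK -eqB dK.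
Qed.

Lemma circuit_mdel M e C : circuit (mdel M e) C <-> circuit M C /\ e \notin C.
Proof.
split=> [/circuitP[/= sC dC minC]|[/circuitP[sC dC minC] eNC]].
  have eNC : e \notin C by move: sC; rewrite subsetD1 => /andP[].
  split=> //; apply/circuitP; split.
  - by move: sC; rewrite subsetD1 => /andP[].
  - by move: dC; rewrite inE eNC andbT.
  - by move=> Y sY dY; apply: minC => //; rewrite inE negb_and dY.
apply/circuitP; split=> /=; first by rewrite subsetD1 sC.
  by rewrite inE negb_and dC.
move=> Y sY; rewrite inE negb_and negbK => /orP[|eY]; first exact: minC.
by rewrite (subsetP sY _ eY) in eNC.
Qed.

(* [k] names an element in series with [e], and is [None] if [e] is a coloop. *)
Definition series_mate M e k :=
  forall C, circuit M C -> (e \in C) = oapp (mem (C :\ e)) false k.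

Lemma coloop_mate M e : coloop M e -> series_mate M e None.
Proof.
move=> he C hC; apply/negbTE/negP => eC.
by have /eqP[] := circuit_cocircuit e hC he; apply/setIidPr; rewrite sub1set.
Qed.

Lemma series_pair_mate M e : in_series_pair M e -> exists f, series_mate M e (Some f).
Proof.
case=> D [hD D2 eD].
have /cards1P[f Df] : #|D :\ e| == 1 by move: D2; rewrite (cardsD1 e) eD => /eqP.
have /setD1P[neq_fe _] : f \in D :\ e by rewrite Df set11.
have {Df} defD : D = [set e; f] by rewrite -(setD1K eD) Df.
exists f => C hC; rewrite /= !inE neq_fe /=.
have h x : C :&: D != [set x] by apply: circuit_cocircuit hC hD.
have neq_ef : e != f by rewrite eq_sym.
apply/idP/idP => [eC|fC].
  apply/negPn/negP => fNC; case/eqP: (h e); apply/setP => x.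
  rewrite defD !inE; case: (eqVneq x e) => [->|_] /=; first by rewrite eC.
  by case: (eqVneq x f) => [->|_]; rewrite ?(negbTE fNC) ?andbF.
apply/negPn/negP => eNC; case/eqP: (h f); apply/setP => x.
rewrite defD !inE; case: (eqVneq x f) => [->|_] /=; first by rewrite fC orbT.
by case: (eqVneq x e) => [->|_]; rewrite ?(negbTE eNC) ?andbF.
Qed.

Section Contraction.
Variables (M : matroid T) (e : T) (k : option T).
Hypotheses (eM : e \in ground M) (ie : [set e] \in indep M).
Hypothesis mate : series_mate M e k.

(** In general only the minimal sets [C :\ e] are circuits of the contraction. Here all of them are
    minimal: [e \in C] can be read off from [C :\ e], so [C2 :\ e \subset C :\ e] forces
    [C2 \subset C]. *)
Lemma circuit_mcontr X :
  circuit (mcontr M e) X <-> exists2 C, circuit M C & X = C :\ e.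
Proof.
split=> [/circuitP[sX dX minX]|[C hC ->{X}]].
  have sXM : X \subset ground M by apply: subset_trans sX (subsetDl _ _).
  rewrite mcontr_indep // in dX.
  have [|C hC sC] := circuit_exists _ dX; first by rewrite subUset sub1set eM.
  exists C => //; symmetry; apply: minX; first by rewrite subDset.
  rewrite mcontr_indep; [|done|exact: setSD (circuit_sub hC)].
  case/circuitP: hC => _ dC _; apply: contra dC => /indep_hered; apply.
  by rewrite -subDset.
move/circuitP: (hC) => [sC dC minC]; apply/circuitP; split; first exact: setSD.
  rewrite mcontr_indep ?setSD //; apply: contra dC => /indep_hered; apply.
  by rewrite -subDset.
move=> Y sY; have sYM := subset_trans sY (setSD [set e] sC).
rewrite mcontr_indep // => dY.
have [|C2 hC2 sC2] := circuit_exists _ dY.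
  by rewrite subUset sub1set eM; apply: subset_trans sYM (subsetDl _ _).
have sC2Y : C2 :\ e \subset Y by rewrite subDset.
have sC2C : C2 \subset C.
  apply/subsetP => x xC2; case: (eqVneq x e) => [xe|xNe]; last first.
    have xC2e : x \in C2 :\ e by rewrite !inE xNe.
    by have /setD1P[] := subsetP sY _ (subsetP sC2Y _ xC2e).
  move: xC2; rewrite xe (mate hC2) (mate hC); case: (k) => //= y.
  by move/(subsetP sC2Y)/(subsetP sY).
apply/eqP; rewrite eqEsubset sY -(minC _ sC2C) //.
by case/circuitP: hC2.
Qed.

Lemma cycle_mcontr X :
  is_cycle (mcontr M e) X <-> exists2 C, is_cycle M C & X = C :\ e.
Proof.
split=> [[P [hP tP ->{X}]]|[_ [P [hP tP ->]] ->{X}]]; last first.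
  rewrite bigcup_setD1.
  apply: is_cycle_bigcup => [D /hP hD|A B AP BP neqAB].
    by apply/circuit_mcontr; exists D.
  apply: disjointWl (subsetDl _ _) _; apply: disjointWr (subsetDl _ _) _.
  by move/trivIsetP: tP; apply.
(* [u] lifts a circuit of the contraction back to [M]: [e] is added exactly when the mate is
   present. *)
pose u Y := if oapp (mem Y) false k then e |: Y else Y.
have uK Y : Y \in P -> circuit M (u Y) /\ u Y :\ e = Y.
  move=> /hP /circuit_mcontr[C hC ->]; rewrite /u -(mate hC).
  case: ifP => [eC|/negbT eNC]; first by rewrite setD1K.
  have -> : C :\ e = C; last split=> //.
    by apply/setP => x; rewrite !inE; case: eqP => // ->; rewrite (negbTE eNC).
  by apply/setP => x; rewrite !inE; case: eqP => // ->; rewrite (negbTE eNC).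
have eNP Y : Y \in P -> e \notin Y.
  by move/uK => [_ <-]; rewrite !inE eqxx.
exists (\bigcup_(Y in P) u Y); last first.
  by rewrite bigcup_setD1; apply: eq_bigr => Y /uK[].
apply: is_cycle_bigcup => [Y /uK[]//|A B AP BP neqAB].
have dAB : [disjoint A & B] by move/trivIsetP: tP; apply.
rewrite disjoints_subset; apply/subsetP => x xA; rewrite inE; apply/negP => xB.
(* The lifts could only newly meet in [e], but then the disjoint sets [A] and [B] would share the
   mate of [e]. *)
have [xe|xNe] := eqVneq x e.
  move: xA xB; rewrite xe /u; case: (k) => [y|] /=; last first.
    by rewrite (negbTE (eNP _ AP)).
  case: ifP => yA; last by rewrite (negbTE (eNP _ AP)).
  case: ifP => yB; last by rewrite (negbTE (eNP _ BP)).
  by rewrite (disjointFr dAB yA) in yB.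
have xuA : x \in A by case: (uK _ AP) => _ <-; rewrite !inE xNe.
have : x \in B by case: (uK _ BP) => _ <-; rewrite !inE xNe.
by rewrite (disjointFr dAB xuA).
Qed.

End Contraction.

Lemma cycle_mdel M e X : is_cycle (mdel M e) X <-> is_cycle M X /\ e \notin X.
Proof.
split=> [[P [hP tP ->]]|[[P [hP tP ->]] eNP]].
  split; first by exists P; split=> // D /hP/circuit_mdel[].
  by apply/bigcupP => -[D /hP/circuit_mdel[_ /negbTE->]].
exists P; split=> // D DP; apply/circuit_mdel; split; first exact: hP.
by apply: contra eNP => eD; apply/bigcupP; exists D.
Qed.

(** * Reading the cycles of a minor as cycles of the original matroid *)

(* The cycles of [N] are the traces of the cycles of [M] avoiding [D], and [g]
   recovers such a cycle of [M] from its trace: [x] belongs to it iff [g x]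
   exists and belongs to the trace. *)
Definition cycle_section M N D g :=
  [/\ ground N \subset ground M, D \subset ground M,
      forall X, is_cycle N X <->
        exists2 C, is_cycle M C /\ [disjoint C & D] & X = C :&: ground N
    & forall C, is_cycle M C -> [disjoint C & D] ->
        forall x, (x \in C) = oapp (mem (C :&: ground N)) false (g x)].

Lemma cycle_section_refl M : cycle_section M M set0 Some.
Proof.
split=> // [|X|C hC _ x /=]; first exact: sub0set.
  split=> [hX|[C [hC _] ->]]; last by rewrite (setIidPl (cycle_sub hC)).
  exists X; last by rewrite (setIidPl (cycle_sub hX)).
  by rewrite disjoint_sym disjoints_subset sub0set.
by rewrite (setIidPl (cycle_sub hC)).
Qed.

(** Since [D'] lies in [ground N], passing to the trace on [ground N] does not affect whether a
    cycle avoids [D']. The two recovery rules can then be applied one after the other. *)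
Lemma cycle_section_trans M N L D D' g g' :
  cycle_section M N D g -> cycle_section N L D' g' ->
  cycle_section M L (D :|: D') (fun x => obind g' (g x)).
Proof.
case=> sNM sDM cN gN [sLN sD'N cL gL].
have disD' C : [disjoint C :&: ground N & D'] = [disjoint C & D'].
  by rewrite -!setI_eq0 -setIA (setIidPr sD'N).
have traceL C : (C :&: ground N) :&: ground L = C :&: ground L.
  by rewrite -setIA (setIidPr sLN).
have disU C : [disjoint C & D :|: D'] = [disjoint C & D] && [disjoint C & D'].
  by rewrite -!setI_eq0 setIUr setU_eq0.
split=> [|||C hC].
- exact: subset_trans sLN sNM.
- by rewrite subUset sDM (subset_trans sD'N).
- move=> X; rewrite cL; split=> [[Y [/cN[C [hC dC] ->]]]|[C [hC]]].
    by rewrite disD' traceL => dC' ->; exists C; rewrite // disU dC dC'.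
  rewrite disU => /andP[dC dC'] ->; exists (C :&: ground N); last by rewrite traceL.
  by split; [apply/cN; exists C | rewrite disD'].
rewrite disU => /andP[dC dC'] x; rewrite (gN _ hC dC).
case: (g x) => //= y; rewrite (gL (C :&: ground N)) ?traceL ?disD' //.
by apply/cN; exists C.
Qed.

Lemma cycle_section_mdel M e : e \in ground M ->
  cycle_section M (mdel M e) [set e] Some.
Proof.
move=> eM; have dis C : [disjoint C & [set e]] = (e \notin C).
  by rewrite disjoint_sym disjoints_subset sub1set inE.
have trace C : is_cycle M C -> e \notin C -> C :&: (ground M :\ e) = C.
  by move=> /cycle_sub sC eNC; apply/setIidPl; rewrite subsetD1 sC.
split=> [||X|C hC]; rewrite ?sub1set ?subsetDl //=.
  rewrite cycle_mdel; split=> [[hX eX]|[C [hC]]].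
    by exists X; rewrite ?dis // trace.
  by rewrite dis => eC ->; rewrite trace.
by rewrite dis => eC x; rewrite /= trace.
Qed.

Lemma cycle_section_mcontr M e k : e \in ground M -> [set e] \in indep M ->
  series_mate M e k ->
  cycle_section M (mcontr M e) set0 (fun x => if x == e then k else Some x).
Proof.
move=> eM ie mate.
have trace C : is_cycle M C -> C :&: (ground M :\ e) = C :\ e.
  by move=> /cycle_sub sC; rewrite setIDA (setIidPl sC).
have dis0 C : [disjoint C & (set0 : {set T})].
  by rewrite disjoint_sym disjoints_subset sub0set.
split=> [||X|C hC _ x]; rewrite ?ground_mcontr ?subsetDl ?sub0set //.
  rewrite (cycle_mcontr eM ie mate).
  by split=> [[C hC ->]|[C [hC _] ->]]; exists C; rewrite ?dis0 // trace.
rewrite trace //; have [->|xNe] := eqVneq x e; last by rewrite /= !inE xNe.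
(* The mate rule is known for circuits; it passes to the cycle through the union of its circuits. *)
case: hC => P [hP _ ->].
have mateP D : D \in P -> (e \in D) = oapp (mem (D :\ e)) false k.
  by move/hP/mate.
case: k {mate} mateP => [f|] /= mateP; last first.
  by apply/bigcupP => -[D /mateP ->].
apply/bigcupP/setD1P => [[D DP]|[fNe /bigcupP[D DP fD]]].
  by rewrite mateP // => /setD1P[-> fD]; split=> //; apply/bigcupP; exists D.
by exists D => //; rewrite mateP // !inE fNe.
Qed.

Lemma in_series_pair_ground M e : in_series_pair M e -> e \in ground M.
Proof. by case=> D [/circuit_sub /subsetP sD _ /sD]. Qed.

Lemma cycle_section_series M e : in_series_pair M e ->
  exists g, cycle_section M (mcontr M e) set0 g.
Proof.
move=> he; have [f mate] := series_pair_mate he.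
have ie : [set e] \in indep M by case: he => D [hD _]; apply: cocircuit_elem_indep.
by eexists; apply: cycle_section_mcontr (in_series_pair_ground he) ie mate.
Qed.

Lemma cycle_section_coloop M e : coloop M e ->
  exists g, cycle_section M (mcontr M e) set0 g.
Proof.
move=> he; have eM : e \in ground M by have := circuit_sub he; rewrite sub1set.
have ie := cocircuit_elem_indep he (set11 e).
by eexists; apply: cycle_section_mcontr eM ie (coloop_mate he).
Qed.

(** The alternative singles out the empty sequence of operations. Any actual operation removes an
    element from the ground set, and such an element supplies the nonzero form when nothing was
    deleted. *)
Lemma series_minor_section M N : series_minor M N ->
  (N = M \/ ground N \proper ground M) /\ exists D g, cycle_section M N D g.
Proof.
have proper_del M0 N0 e : e \in ground N0 ->
    N0 = M0 \/ ground N0 \proper ground M0 -> ground N0 :\ e \proper ground M0.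
  by move=> eN [<-|/proper_sub sNM]; [|apply: proper_sub_trans sNM]; apply: properD1.
elim=> [|{}N e _ [prN [D [g secN]]] eN|{}N e _ [prN [D [g secN]]] eN].
- by split; [left | exists set0, Some; apply: cycle_section_refl].
- split; first by right; apply: proper_del.
  by do 2!eexists; apply: cycle_section_trans secN (cycle_section_mdel eN).
- split; first by right; apply: proper_del prN; apply: in_series_pair_ground.
  have [g' sec'] := cycle_section_series eN.
  by do 2!eexists; apply: cycle_section_trans secN sec'.
Qed.

End Matroids.

Local Open Scope ring_scope.

(** * Isomorphisms and faces of convex hulls *)

Section Polytopes.
Variable R : realType.

(** Linear maps commute with affine combinations, so it suffices to check everything on generators;
    the maps are their own affine extensions. *)
Lemma affinely_isomorphic_conv_hull (V W : lmodType R) (A : set V) (B : set W)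
    (f : {linear V -> W}) (h : {linear W -> V}) :
  (forall v, A v -> B (f v)) -> (forall w, B w -> A (h w)) ->
  (forall v, A v -> h (f v) = v) -> (forall w, B w -> f (h w) = w) ->
  affinely_isomorphic (conv_hull A) (conv_hull B).
Proof.
have comb (V' W' : lmodType R) (k : {linear V' -> W'}) n (c : 'I_n -> R) p :
    k (\sum_i c i *: p i) = \sum_i c i *: k (p i).
  by rewrite linear_sum; apply: eq_bigr => i _; rewrite linearZ.
have conv (V' W' : lmodType R) (k : {linear V' -> W'}) (A' : set V') (B' : set W') :
    (forall v, A' v -> B' (k v)) -> forall v, conv_hull A' v -> conv_hull B' (k v).
  move=> AB _ [n [c [p [Ap c0 c1 ->]]]]; exists n, c, (k \o p).
  by split=> // [i|]; [apply: AB | rewrite comb].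
have aff (V' W' : lmodType R) (k : {linear V' -> W'}) (A' : set V') (B' : set W') :
    (forall v, A' v -> B' (k v)) -> forall v, aff_hull A' v -> aff_hull B' (k v).
  move=> AB _ [n [c [p [Ap c1 ->]]]]; exists n, c, (k \o p).
  by split=> // [i|]; [apply: AB | rewrite comb].
have morph (V' W' : lmodType R) (k : {linear V' -> W'}) (A' : set V') (B' : set W') :
    (forall v, A' v -> B' (k v)) -> polytope_morphism (conv_hull A') (conv_hull B') k.
  move=> AB; split; first exact: conv.
  by exists k; split=> //; [apply/aff/conv | move=> *; apply: comb].
have inv (V' W' : lmodType R) (k : {linear V' -> W'}) (k' : {linear W' -> V'}) (A' : set V') :
    (forall v, A' v -> k' (k v) = v) -> forall v, conv_hull A' v -> k' (k v) = v.
  move=> kK _ [n [c [p [Ap _ _ ->]]]]; rewrite !comb.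
  by apply: eq_bigr => i _; rewrite kK.
by move=> AB BA fK hK; exists f, h; split; [exact: morph|exact: morph|exact: inv|exact: inv].
Qed.

(** A convex combination on the hyperplane has weighted slacks that are nonnegative and sum to 0, so
    only generators on the hyperplane carry weight. The point [v0] shows that the hyperplane is
    attained. *)
Lemma conv_hull_face (I : finType) (A : set {ffun I -> R^o})
    (a : {ffun I -> R^o}) (b : R) (v0 : {ffun I -> R^o}) :
  a != 0 -> (forall v, A v -> \sum_i a i * v i <= b) -> A v0 -> hyperplane a b v0 ->
  is_face (conv_hull A) (conv_hull [set v | A v /\ hyperplane a b v]).
Proof.
move=> a0 leA Av0 av0; exists a, b.
have comb n (c : 'I_n -> R) (p : 'I_n -> {ffun I -> R^o}) :
    \sum_i a i * (\sum_j c j *: p j) i = \sum_j c j * (\sum_i a i * p j i).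
  under [RHS]eq_bigr => j _ do rewrite mulr_sumr.
  rewrite exchange_big; apply: eq_bigr => i _; rewrite sum_ffunE mulr_sumr.
  by apply: eq_bigr => j _; rewrite ffunE mulrCA.
split.
  split=> //.
    move=> _ [n [c [p [Ap c0 c1 ->]]]]; rewrite comb -[b]mul1r -c1 mulr_suml.
    by apply: ler_sum => j _; apply: ler_wpM2l; rewrite ?c0 ?leA.
  exists v0; split=> //; exists 1%N, (fun=> 1), (fun=> v0).
  by split=> //; rewrite big_ord1 ?scale1r.
apply/seteqP; split=> [_ [n [c [p [Ap c0 c1 ->]]]]|x [[n [c [p [Ap c0 c1 ->]]]]]].
  split; first by exists n, c, p; split=> // i; case: (Ap i).
  rewrite /hyperplane /= comb -[RHS]mul1r -c1 mulr_suml.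
  by apply: eq_bigr => j _; case: (Ap j) => _ ->.
rewrite /hyperplane /= comb => eqb.
have slack j : c j * (b - \sum_i a i * p j i) = 0.
  apply: (@psumr_eq0P _ _ predT (fun j => c j * (b - \sum_i a i * p j i))) => // [i _|].
    by rewrite mulr_ge0 ?c0 // subr_ge0 leA.
  under eq_bigr do rewrite mulrBr.
  by rewrite sumrB eqb -mulr_suml c1 mul1r subrr.
(* a generator off the hyperplane has weight 0, so it may be replaced by [v0] *)
exists n, c, (fun j => if c j == 0 then v0 else p j); split=> //.
  move=> j; case: eqVneq => [//|cj0]; split=> //; apply/esym/eqP.
  by have /eqP := slack j; rewrite mulf_eq0 (negbTE cj0) subr_eq0.
by apply: eq_bigr => j _; case: eqVneq => // ->; rewrite !scale0r.
Qed.

(** * Linear maps that reindex coordinates *)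

Section Pullback.
Variables (T : finType) (E E' : {set T}) (k : T -> option T).

(** Coordinate [x] of the image is coordinate [k x] of [v], read as 0 if [k x] is [None] or outside
    [E]. Both the projection to a minor ([k = Some]) and the lift from it ([k = g]) have this
    form. *)
Definition pullback (v : {ffun {x | x \in E} -> R^o}) : {ffun {x | x \in E'} -> R^o} :=
  [ffun x => oapp v 0 (obind insub (k (val x)))].

Lemma pullback_is_linear : linear pullback.
Proof.
move=> c u v; apply/ffunP => x; rewrite !ffunE.
by case: (obind _ _) => [y|] /=; rewrite ?ffunE // scaler0 addr0.
Qed.

HB.instance Definition _ :=
  GRing.isLinear.Build R _ _ _ pullback pullback_is_linear.

Lemma pullback_char_vec (C C' : {set T}) :
  (forall x, x \in E' -> (x \in C') = oapp (mem (C :&: E)) false (k x)) ->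
  pullback (char_vec R E C) = char_vec R E' C'.
Proof.
move=> kC; apply/ffunP => x; rewrite !ffunE kC ?(valP x) //.
case: (k (val x)) => //= y; rewrite in_setI.
by case: insubP => [z -> <-|/negbTE ->] /=; rewrite ?ffunE ?andbT ?andbF.
Qed.

End Pullback.

(** * Supporting hyperplanes and the face belonging to a minor *)

Section Faces.
Variables (T : finType) (M : matroid T).
Implicit Types (N : matroid T) (D C : {set T}) (o : option T).

Lemma sum_char_vec (E C : {set T}) (F : T -> R) :
  \sum_(i : {x | x \in E}) F (val i) * char_vec R E C i =
  \sum_(x in E) F x * (x \in C)%:R.
Proof. by rewrite [RHS]big_sub; apply: eq_bigr => i _; rewrite ffunE. Qed.

(** The coefficients define the coordinate functional at [o], which is the zero form if [o] is
    [None] or outside [E]. *)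
Lemma sum_option_char_vec (E C : {set T}) o :
  \sum_(i : {x | x \in E}) (Some (val i) == o)%:R * char_vec R E C i =
  (oapp (mem (C :&: E)) false o)%:R.
Proof.
rewrite (sum_char_vec _ _ (fun x => (Some x == o)%:R)).
case: o => [y|] /=; last by rewrite big1 // => x _; rewrite mul0r.
rewrite in_setI; have [yE|yNE] := boolP (y \in E).
  rewrite (bigD1 y) //= eqxx mul1r big1 ?addr0 ?andbT // => x /andP[_ xNy].
  by rewrite (inj_eq Some_inj) (negbTE xNy) mul0r.
rewrite big1 ?andbF // => x xE; rewrite (inj_eq Some_inj).
by case: eqVneq => [xy|_]; [rewrite -xy xE in yNE | rewrite mul0r].
Qed.

Lemma cycle_section_hyperplane N D g :
  cycle_section M N D g -> ground N \proper ground M ->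
  exists a : {ffun {x | x \in ground M} -> R^o},
    a != 0 /\ forall C, is_cycle M C ->
      \sum_i a i * char_vec R (ground M) C i <= 0 /\
      (hyperplane a 0 (char_vec R (ground M) C) <-> [disjoint C & D]).
Proof.
case=> sNM sDM _ gN prN; have [D0|[d dD]] := set_0Vmem D.
  have [_ [e eM eNN]] := properP prN.
  (* [o] is the coordinate that [x_e] equals on the whole polytope, if any *)
  pose o := obind (fun y => if y \in ground N then Some y else None) (g e).
  exists [ffun i => (Some (val i) == Some e)%:R - (Some (val i) == o)%:R]; split.
    (* The coefficient at [e] is 1: [o] is restricted to [ground N], which misses [e], so the two
       terms cannot cancel. *)
    apply/eqP => /ffunP /(_ (exist _ e eM)); rewrite !ffunE /= eqxx.
    rewrite /o; case: (g e) => [y|] /=; last by rewrite subr0; apply/eqP/oner_neq0.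
    case: ifP => [yN|_]; last by rewrite subr0; apply/eqP/oner_neq0.
    have -> : (Some e == Some y) = false.
      by apply/negbTE; apply: contraNneq eNN => -[->].
    by rewrite subr0; apply/eqP/oner_neq0.
  move=> C hC; have dCD : [disjoint C & D].
    by rewrite D0 disjoint_sym disjoints_subset sub0set.
  suff eq0 : hyperplane [ffun i => (Some (val i) == Some e)%:R - (Some (val i) == o)%:R]
      0 (char_vec R (ground M) C) by split=> //; rewrite eq0.
  rewrite /hyperplane /=; under eq_bigr do rewrite ffunE mulrBl.
  rewrite sumrB !sum_option_char_vec /= in_setI eM andbT (gN _ hC dCD) /o.
  case: (g e) => [y|] /=; last by rewrite subrr.
  rewrite in_setI; case: ifP => [yN|_] /=; last by rewrite andbF subrr.
  by rewrite in_setI (subsetP sNM _ yN) subrr.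
have dM := subsetP sDM _ dD.
exists [ffun i => - (val i \in D)%:R]; split.
  apply/eqP => /ffunP /(_ (exist _ d dM)); rewrite !ffunE /= dD.
  by apply/eqP; rewrite oppr_eq0 oner_neq0.
move=> C hC; rewrite /hyperplane /=.
under eq_bigr do rewrite ffunE mulNr.
rewrite sumrN (sum_char_vec _ _ (fun x => (x \in D)%:R)).
have ge0 x : x \in ground M -> 0 <= (x \in D)%:R * (x \in C)%:R :> R.
  by rewrite mulr_ge0 ?ler0n.
split; first by rewrite oppr_le0 sumr_ge0.
split=> [/eqP|dCD].
  rewrite oppr_eq0 => /eqP /(psumr_eq0P ge0) eq0.
  rewrite disjoints_subset; apply/subsetP => x xC; rewrite inE.
  apply/negP => xD; have /eqP := eq0 x (subsetP sDM _ xD).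
  by rewrite xC xD mulr1 oner_eq0.
apply/eqP; rewrite oppr_eq0 big1 // => x _.
by have [xC|] := boolP (x \in C); rewrite ?mulr0 // (disjointFr dCD xC) mul0r.
Qed.

(** The face is the hull of the vectors of the cycles avoiding [D]. Restriction to [ground N] and
    the lift along [g] are linear and mutually inverse on the generators. *)
Lemma cycle_section_face N D g :
  cycle_section M N D g -> ground N \proper ground M ->
  exists F, is_face (cycle_polytope R M) F /\
            affinely_isomorphic (cycle_polytope R N) F.
Proof.
move=> secN prN; have [a [a0 ha]] := cycle_section_hyperplane secN prN.
case: secN => sNM sDM cN gN.
eexists; split.
  (* The empty cycle avoids every [D], so its vector is a point of the face. *)
  apply: (conv_hull_face (a := a) (b := 0) (v0 := char_vec R (ground M) set0)) => //.
  - by move=> _ [C hC ->]; case: (ha C hC).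
  - by exists set0 => //; apply: cycle0.
  - apply/(ha _ (cycle0 M)).2.
    by rewrite disjoint_sym disjoints_subset setC0 subsetT.
have lift C : is_cycle M C -> [disjoint C & D] ->
    pullback (ground M) g (char_vec R (ground N) (C :&: ground N)) =
    char_vec R (ground M) C.
  move=> hC dC; apply: pullback_char_vec => x _.
  by rewrite -setIA setIid; apply: gN.
have trace C : pullback (ground N) Some (char_vec R (ground M) C) =
    char_vec R (ground N) (C :&: ground N).
  by apply: pullback_char_vec => x xN; rewrite /= !in_setI xN (subsetP sNM _ xN).
apply: (@affinely_isomorphic_conv_hull _ _ _ _
  (pullback (ground M) g) (pullback (ground N) Some)).
- move=> _ [_ /cN[C [hC dC] ->] ->]; rewrite /= lift //.
  by split; [exists C | apply/(ha C hC).2].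
- move=> _ [[C hC ->] /(ha C hC).2 dC]; rewrite /= trace.
  by exists (C :&: ground N) => //; apply/cN; exists C.
- by move=> _ [_ /cN[C [hC dC] ->] ->]; rewrite /= lift // trace.
- by move=> _ [[C hC ->] /(ha C hC).2 dC]; rewrite /= trace lift.
Qed.

End Faces.
End Polytopes.

(* A polytope is a face of itself only in the sense of the improper face; this
   is needed for the empty sequence of operations, [M' = M], and only there. *)
Theorem theorem3p1 (R : realType) (T : finType) (M M' : matroid T)
    (M_nonfree : nonfree M) (M'_nonfree : nonfree M') :
  ((exists2 e : T, e \in ground M &
      [\/ M' = mdel M e,
          M' = mcontr M e /\ in_series_pair M e
        | M' = mcontr M e /\ coloop M e]) ->
    exists F,
      is_face (cycle_polytope R M) F /\
      affinely_isomorphic (cycle_polytope R M') F)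
  /\
  (series_minor M M' ->
    exists F,
      (is_face (cycle_polytope R M) F \/ M' = M /\ F = cycle_polytope R M) /\
      affinely_isomorphic (cycle_polytope R M') F).
Proof.
split=> [[e eM step]|/series_minor_section[[->|prM'] [D [g sec]]]].
- have [D [g sec]] : exists D g, cycle_section M M' D g.
    case: step => [->|[-> /cycle_section_series sec]|[-> /cycle_section_coloop sec]].
    + by exists [set e]%SET, Some; apply: cycle_section_mdel.
    + by exists set0.
    + by exists set0.
  apply: (cycle_section_face R sec).
  by case: step => [->|[-> _]|[-> _]]; apply: properD1.
- exists (cycle_polytope R M); split; first by right.
  by apply: (@affinely_isomorphic_conv_hull _ _ _ _ _ idfun idfun).
- have [F [faceF isoF]] := cycle_section_face R sec prM'.
  by exists F; split; [left|].
Qed.
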